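(* Let $n = 4r+1$ with $r$ a positive integer. Let $b$ be a positive integer with $b \equiv 3 \pmod 4$, and define \[ x = \frac{n+b}{4}. \] If $b \mid n$, then there exists a positive integer $t$ such that $F_{x,t}^{(4)}(n) = 0$. This yields the symmetric solution \[ y = z = t(4x-n) = tb, \] satisfying \[ \frac{4}{n} = \frac{1}{x} + \frac{1}{y} + \frac{1}{z}. \]
   Context: For positive integers $x,t$ and a natural number $n$, define \[ F_{x,t}^{(4)}(n) = t^2(4x-n)^2 - 2nxt. \] A solution of $\frac{4}{n} = \frac{1}{x} + \frac{1}{y} + \frac{1}{z}$ means a solution in positive integers $x,y,z$; it is called symmetric if $y=z$. *)

(* Defs.v *)
From HB Require Import structures.
From mathcomp Require Import all_boot all_order all_algebra.

Set Implicit Arguments.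
Unset Strict Implicit.
Unset Printing Implicit Defensive.

Import GRing.Theory Num.Theory.
Local Open Scope ring_scope.

(* Valued in int because 4 x - n may be negative; x and t are meant to be
   positive, which is required wherever F4 is used. *)
Definition F4 (x t n : nat) : int :=
  t%:Z ^+ 2 * (4 * x%:Z - n%:Z) ^+ 2 - 2 * n%:Z * x%:Z * t%:Z.

Definition is_solution (n x y z : nat) : Prop :=
  [/\ (0 < x)%N, (0 < y)%N, (0 < z)%N &
      4 / n%:Q = 1 / x%:Q + 1 / y%:Q + 1 / z%:Q].

Definition is_symmetric_solution (n x y z : nat) : Prop :=
  is_solution n x y z /\ y = z.

(* Main.v *)
(* Write n = b m. Since n = 1 and b = 3 modulo 4, also m = 3 modulo 4, so
   m + 1 = 4 q and x = b q. As 4 x - n = b, the equation F = 0 reads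
   t b^2 = 2 n x, whose solution is t = 2 m q. *)
Require Import Defs.
From HB Require Import structures.
From mathcomp Require Import all_boot all_order all_algebra.
From mathcomp Require Import ring zify.

Set Implicit Arguments.
Unset Strict Implicit.
Unset Printing Implicit Defensive.

Import GRing.Theory Num.Theory.
Local Open Scope ring_scope.

(** Since [4x - n = b], one has [4/n - 1/x = b/(nx)], so [y = z = tb] solves the equation exactly
    when [t b^2 = 2nx], which is [F4 x t n = 0]. Divisibility makes [t] integral: with [n = mb] and
    [x = bq], [b^2] cancels and [t = 2mq]. *)

Theorem proposition4 (n r b : nat)
    (hr : (0 < r)%N) (hn : n = (4 * r + 1)%N)
    (hb : (0 < b)%N) (hb3 : b = 3 %[mod 4]) (hbn : (b %| n)%N) :
  exists x : nat,
    [/\ (0 < x)%N,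
        x%:Q = (n%:Q + b%:Q) / 4 &
        exists t : nat,
          [/\ (0 < t)%N,
              F4 x t n = 0 &
              exists y z : nat,
                [/\ y%:Z = t%:Z * (4 * x%:Z - n%:Z),
                    z%:Z = t%:Z * (4 * x%:Z - n%:Z),
                    y = (t * b)%N,
                    z = (t * b)%N &
                    is_symmetric_solution n x y z]]].
Proof.
have [m nE] := dvdnP hbn.
have [q [q_gt0 mE]] : exists q, (0 < q)%N /\ (m + 1 = 4 * q)%N.
  have m3 : (m %% 4 = 3)%N.
    (* Reduce [n = m * b] modulo 4; 3 is the only residue whose triple is 1. *)
    have : (m %% 4 * 3 %% 4 = 1)%N.
      by have := modnMm m b 4; rewrite hb3 -nE hn [(4 * r)%N]mulnC modnMDl.
    by have := ltn_pmod m (isT : 0 < 4)%N; case: (m %% 4)%N => [|[|[|[|?]]]].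
  by exists (m %/ 4).+1; lia.
have m_gt0 : (0 < m)%N by lia.
have mZ : m%:Z = 4 * q%:Z - 1 by lia.
have nZ : n%:Z = m%:Z * b%:Z by rewrite nE PoszM.
have xZ : 4 * (b * q)%N%:Z - n%:Z = b%:Z by rewrite nZ mZ PoszM; ring.
have mQ : m%:Q = 4 * q%:Q - 1 by rewrite mZ rmorphB rmorphM.
have nQ : n%:Q = m%:Q * b%:Q by rewrite nZ rmorphM.
exists (b * q)%N; split.
- by rewrite muln_gt0 hb.
- by rewrite nQ mQ PoszM rmorphM /=; field.
exists (2 * m * q)%N; split.
- by rewrite !muln_gt0 m_gt0.
- by rewrite /F4 xZ nZ !PoszM; ring.
exists (2 * m * q * b)%N, (2 * m * q * b)%N; split=> //.
- by rewrite xZ PoszM.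
- by rewrite xZ PoszM.
split=> //; split; rewrite ?muln_gt0 ?hb ?m_gt0 ?q_gt0 //.
(* All denominators [n], [x], [tb] are products of 2, [b], [q] and [m], the last written [4q - 1] so
   that [field] sees only [b] and [q]. *)
have b0 : b%:Q != 0 by rewrite intr_eq0; lia.
have q0 : q%:Q != 0 by rewrite intr_eq0; lia.
have m0 : 4 * q%:Q - 1 != 0 by rewrite -mQ intr_eq0; lia.
rewrite nQ !PoszM !rmorphM /= mQ; field.
by rewrite b0 q0 m0.
Qed.
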